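(* Let $\alpha\in(0,1)$. If all jobs are $\alpha$-tight, i.e. $p_j>\alpha(d_j-r_j)$ for every job $j$, and the instance has agreeable deadlines, then the competitive ratio of LLF for preemptive semi-online machine minimization is at most $4/\alpha+6$; i.e. LLF run on $(4/\alpha+6)\cdot m$ machines produces a feasible schedule, where $m$ is the optimal number of machines.
   Context: Machine minimization with deadlines: each job $j$ of a finite instance has integer release date $r_j$, processing time $p_j$ and deadline $d_j$. A feasible preemptive schedule on a given number of identical machines processes each job for $p_j$ units within $[r_j,d_j]$, each machine processing at most one job at a time, no job on two machines at once; preemption and migration are allowed. $m$ is the minimum number of machines admitting a feasible schedule. Semi-online: jobs become known at their release dates, and $m$ is known in advance. $c$-competitive: always produces a feasible schedule with at most $c\cdot m$ machines (treated as an integer). Agreeable deadlines: for any jobs $j,k$ with $r_j<r_k$ we have $d_j\le d_k$. For an algorithm, $p_j(t)$ is the remaining processing time of $j$ at time $t$ and the laxity is $\ell_j(t)=d_j-t-p_j(t)$. Least Laxity First (LLF) on $k$ machines makes decisions at integer times and at each time processes the $k$ released, unfinished jobs with smallest non-negative laxity, ties broken in favor of earlier release date, then smaller index. *)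

(* Defs.v *)
From HB Require Import structures.
From mathcomp Require Import all_boot all_order all_algebra.
From mathcomp Require Import all_classical all_reals all_analysis.

Set Implicit Arguments.
Unset Strict Implicit.
Unset Printing Implicit Defensive.

Import Order.TTheory GRing.Theory Num.Theory.

Local Open Scope ring_scope.

Record job := Job { release : int; proc : nat; deadline : int }.

(* [None] means that the machine idles at that time. *)
Definition schedule (R : realType) (n k : nat) := 'I_k -> R -> option 'I_n.

(* Preemption and migration are unrestricted (up to measurability). *)
Definition feasible (R : realType) (n k : nat) (J : 'I_n -> job)
    (S : schedule R n k) : Prop :=
  [/\ forall (i : 'I_k) (j : 'I_n),
        measurable ([set x | S i x = Some j]%classic : set R),
      forall (i i' : 'I_k) (x : R) (j : 'I_n),
        S i x = Some j -> S i' x = Some j -> i = i',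
      forall (i : 'I_k) (x : R) (j : 'I_n), S i x = Some j ->
        (release (J j))%:~R <= x <= (deadline (J j))%:~R &
      forall j : 'I_n,
        (@lebesgue_measure R [set x | exists i : 'I_k, S i x = Some j]%classic
         = (proc (J j))%:R%:E)%E].

Definition schedulable (R : realType) (n : nat) (J : 'I_n -> job) (k : nat)
    : Prop :=
  exists S : schedule R n k, feasible J S.

Definition min_machines (R : realType) (n : nat) (J : 'I_n -> job) (m : nat)
    : Prop :=
  schedulable R J m /\ forall k : nat, schedulable R J k -> (m <= k)%N.

Definition tight (R : realType) (n : nat) (alpha : R) (J : 'I_n -> job)
    : Prop :=
  forall j : 'I_n,
    alpha * (deadline (J j) - release (J j))%:~R < (proc (J j))%:R.

Definition agreeable (n : nat) (J : 'I_n -> job) : Prop :=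
  forall j k : 'I_n,
    release (J j) < release (J k) -> deadline (J j) <= deadline (J k).

Section LeastLaxityFirst.

Variables (n : nat) (J : 'I_n -> job) (k : nat).

Implicit Types (rem : 'I_n -> nat) (t : int) (i j : 'I_n).

(* [rem j] is the remaining processing time of job [j] at time [t]. *)
Definition laxity rem t j : int := deadline (J j) - t - (rem j)%:Z.

Definition eligible rem t j : bool :=
  [&& release (J j) <= t, (0 < rem j)%N & 0 <= laxity rem t j].

Definition precedes rem t i j : bool :=
  (laxity rem t i < laxity rem t j)
  || (laxity rem t i == laxity rem t j)
     && ((release (J i) < release (J j))
         || (release (J i) == release (J j)) && (i < j)%N).

Definition llf_rank rem t j : nat :=
  #|[set i | eligible rem t i && precedes rem t i j]|.

(* The [k] eligible jobs of highest priority, or all if there are fewer. *)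
Definition llf_choice rem t j : bool :=
  eligible rem t j && (llf_rank rem t j < k)%N.

(* A time no later than any release date, from which LLF is simulated. *)
Definition llf_start : int := \big[Num.min/0]_(j < n) release (J j).

(* Remaining processing times at time [llf_start + s]. *)
Fixpoint llf_rem_after (s : nat) : 'I_n -> nat :=
  if s is s'.+1 then
    fun j => (llf_rem_after s' j
              - llf_choice (llf_rem_after s') (llf_start + s'%:Z) j)%N
  else fun j => proc (J j).

Definition llf_rem t : 'I_n -> nat :=
  match t - llf_start with
  | Posz s => llf_rem_after s
  | Negz _ => fun j => proc (J j)
  end.

(* Machine [i] executes the eligible job of rank [i] during [t, t + 1[, for
   every integer [t]; the rank is injective on eligible jobs. *)
Definition llf_schedule (R : realType) : schedule R n k :=
  fun (i : 'I_k) (x : R) =>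
    let t := Num.floor x in
    [pick j | eligible (llf_rem t) t j && (llf_rank (llf_rem t) t j == i :> nat)].

End LeastLaxityFirst.

Arguments llf_schedule {n} J k R.

(* Main.v *)
Require Import Defs.
From mathcomp Require Import all_boot all_order all_algebra.
From mathcomp Require Import all_classical all_reals all_analysis.
From mathcomp Require Import zify ring lra.
Import Order.TTheory GRing.Theory Num.Theory.
Local Open Scope ring_scope.

(* Call a delay of a job [j] at time [t] late when [t - r_j >= l_j(t)]. A job
   that misses its deadline is delayed at laxity 0, hence late, so it suffices
   to show that no delay is late. Before the first late delay, an unfinished
   job has initial laxity at most [2 l_j(t) + 1]: its last delay was early, and
   it was delayed at most once per time unit since its release.

   Suppose that the first late delay hits [j] at [t], and let [L = l_j(t) + 1].
   The [k] jobs preferred to [j], and [j] itself, have initial laxity below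
   [2 L]. Their windows have length at least [L]: a job released after [j] has
   a later deadline, hence at least [L] time units left, and a job released no
   later than [j] has already been available for [l_j(t)] time units. In any
   feasible schedule each of them is processed for at least [alpha L] time units
   within [[t - (2 + alpha) L, t + (2 + alpha) L]]: by tightness if its window
   is contained in this interval, and otherwise because its window covers the
   left or the right half of the interval, where the job idles for less than
   [2 L]. Hence [(k + 1) alpha <= (4 + 2 alpha) m], a contradiction. *)

(** * Delays and laxity in a run of LLF *)

Section Simulation.
Context {n : nat} (J : 'I_n -> job) (k : nat).
Local Notation rem := (llf_rem J k).
Local Notation chosen t := (llf_choice J k (rem t) t).

Lemma llf_start_le_release (j : 'I_n) : llf_start J <= release (J j).
Proof. by rewrite /llf_start; apply: bigmin_le_cond. Qed.

Lemma llf_rem_before (t : int) (j : 'I_n) :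
  t <= llf_start J -> rem t j = proc (J j).
Proof.
move=> ts; rewrite /llf_rem; case E: (t - _) => [s|s] //.
by have -> : s = 0%N by lia.
Qed.

Lemma llf_remS (t : int) (j : 'I_n) :
  rem (t + 1) j = (rem t j - chosen t j)%N.
Proof.
have [ts|ts] := ltP t (llf_start J).
  (* Before [llf_start] no job is released, so none is eligible and nothing changes. *)
  rewrite !llf_rem_before; try lia.
  rewrite /llf_choice /eligible leNgt (lt_le_trans ts (llf_start_le_release j)).
  by rewrite subn0.
have [s ->] : exists s : nat, t = llf_start J + s%:Z.
  by exists `|t - llf_start J|%N; lia.
rewrite /llf_rem.
have -> : llf_start J + s%:Z + 1 - llf_start J = s.+1%:Z by lia.
by have -> : llf_start J + s%:Z - llf_start J = s%:Z by lia.
Qed.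

Lemma chosen_eligible (t : int) (j : 'I_n) :
  chosen t j -> eligible J (rem t) t j.
Proof. by case/andP. Qed.

Lemma llf_rem_release (t : int) (j : 'I_n) :
  t <= release (J j) -> rem t j = proc (J j).
Proof.
move=> tr; have [ts|ts] := leP t (llf_start J); first exact: llf_rem_before.
have [s ts'] : exists s : nat, t = llf_start J + s%:Z.
  by exists `|t - llf_start J|%N; lia.
elim: s t ts' tr {ts} => [|s IH] t ts' tr; first by rewrite llf_rem_before; lia.
have -> : t = (t - 1) + 1 by lia.
rewrite llf_remS IH; try lia.
suff -> : chosen (t - 1) j = false by rewrite subn0.
by apply/negbTE/negP => /chosen_eligible/and3P[]; lia.
Qed.

Lemma laxity_chosen (t : int) (j : 'I_n) : chosen t j ->
  laxity J (rem (t + 1)) (t + 1) j = laxity J (rem t) t j.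
Proof.
move=> cj; rewrite /laxity llf_remS cj.
by have /and3P[_ + _] := chosen_eligible _ _ cj; lia.
Qed.

Lemma laxity_delayed (t : int) (j : 'I_n) : ~~ chosen t j ->
  laxity J (rem (t + 1)) (t + 1) j = laxity J (rem t) t j - 1.
Proof. by move=> cj; rewrite /laxity llf_remS (negbTE cj); lia. Qed.

(** The initial laxity: the time for which the job idles within its window in any feasible
    schedule. *)
Definition slack (j : 'I_n) : int :=
  deadline (J j) - release (J j) - (proc (J j))%:Z.

(** [slack j] minus the laxity counts the delays of [j] so far. The second bound allows one per time
    unit; the third follows if the last one was early. *)
Definition laxity_invariant (t : int) : Prop :=
  forall j : 'I_n, release (J j) <= t -> (0 < rem t j)%N ->
  [/\ 0 <= laxity J (rem t) t j,
      slack j <= laxity J (rem t) t j + (t - release (J j)) &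
      slack j <= 2 * laxity J (rem t) t j + 1].

Definition no_late_delay (t : int) : Prop :=
  forall j : 'I_n, eligible J (rem t) t j -> ~~ chosen t j ->
  t - release (J j) < laxity J (rem t) t j.

Context (slack_ge0 : forall j : 'I_n, (0 < proc (J j))%N -> 0 <= slack j).

Lemma laxity_invariant_release (t : int) (j : 'I_n) :
  release (J j) = t -> (0 < rem t j)%N ->
  [/\ 0 <= laxity J (rem t) t j,
      slack j <= laxity J (rem t) t j + (t - release (J j)) &
      slack j <= 2 * laxity J (rem t) t j + 1].
Proof.
move=> <-; rewrite /laxity llf_rem_release // => p0.
by have := slack_ge0 j p0; rewrite /slack; split; lia.
Qed.

Lemma laxity_invariantS (t : int) :
  laxity_invariant t -> no_late_delay t -> laxity_invariant (t + 1).
Proof.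
move=> inv nld j rj remj.
have [rt|rt] := eqVneq (release (J j)) (t + 1).
  exact: laxity_invariant_release.
have rjt : release (J j) <= t by lia.
have remt : (0 < rem t j)%N by rewrite llf_remS in remj; lia.
have [lax0 slack1 slack2] := inv j rjt remt.
have [cj|cj] := boolP (chosen t j).
  by rewrite laxity_chosen //; split; lia.
have : eligible J (rem t) t j by rewrite /eligible rjt remt lax0.
(* With [l] the laxity before this early delay, the slack is at most [l + (t - r) <= 2 * l - 1 = 2 *
   (l - 1) + 1], and [l > t - r >= 0] keeps [l - 1] non-negative. *)
by move=> /nld/(_ cj) late; rewrite laxity_delayed //; split; lia.
Qed.

Lemma laxity_invariant_llf :
  (forall t : int, laxity_invariant t -> no_late_delay t) ->
  forall t : int, laxity_invariant t.
Proof.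
move=> nld t; have [ts|ts] := ltP t (llf_start J).
  by move=> j; have := llf_start_le_release j; lia.
have [s ->] : exists s : nat, t = llf_start J + s%:Z.
  by exists `|t - llf_start J|%N; lia.
elim: s => [|s IH].
  move=> j rj; apply: laxity_invariant_release.
  by have := llf_start_le_release j; lia.
have -> : llf_start J + s.+1%:Z = llf_start J + s%:Z + 1 by lia.
by apply: laxity_invariantS => //; exact: nld.
Qed.

End Simulation.

(** * Volume of work in an interval under a feasible schedule *)

Section Volume.
Local Open Scope classical_set_scope.
Context {R : realType} {n m : nat} {J : 'I_n -> job}.
Context {S : schedule R n m} (hS : feasible J S).
Local Notation mu := (@lebesgue_measure R).

Definition busy (j : 'I_n) : set R := [set x | exists i : 'I_m, S i x = Some j].

Lemma measurable_busy (j : 'I_n) : measurable (busy j).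
Proof.
have [mS _ _ _] := hS.
have -> : busy j = \bigcup_(i in [set: 'I_m]) [set x | S i x = Some j].
  by apply/seteqP; split=> x [i] => [Sij|_ Sij]; exists i.
by apply: fin_bigcup_measurable => [|i _]; [exact: finite_finset|exact: mS].
Qed.

Lemma busy_window (j : 'I_n) :
  busy j `<=` `[(release (J j))%:~R, (deadline (J j))%:~R].
Proof. by have [_ _ win _] := hS => x [i /win]; rewrite /= in_itv. Qed.

Lemma mu_busy (j : 'I_n) : mu (busy j) = (proc (J j))%:R%:E.
Proof. by have [_ _ _] := hS; apply. Qed.

(** Exchange the sums over jobs and machines: on one machine, distinct jobs occupy disjoint subsets
    of [W]. *)
Lemma sum_busy_le (G : {set 'I_n}) (W : set R) (w : R) :
  measurable W -> mu W = w%:E ->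
  (\sum_(j in G) mu (busy j `&` W) <= (m%:R * w)%:E)%E.
Proof.
move=> mW muW; have [mS once _ _] := hS.
pose A (i : 'I_m) (j : 'I_n) : set R := [set x | S i x = Some j] `&` W.
have mA i j : measurable (A i j) by apply: measurableI => //; exact: mS.
have busyA j : mu (busy j `&` W) = \sum_(i < m) mu (A i j).
  transitivity (mu (\big[setU/set0]_(i in 'I_m) A i j)).
    rewrite -bigcup_pred; congr (mu _); apply/seteqP; split=> x /=.
      by move=> [[i Sij] Wx]; exists i.
    by move=> [i _ [Sij Wx]]; split=> //; exists i.
  apply: measure_bigsetU_ord => [i|]; first exact: mA.
  by move=> i i' _ _ [x [[/= Si _] [/= Si' _]]]; exact: once Si Si'.
under eq_bigr do rewrite busyA; rewrite exchange_big /=.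
have machine i : (\sum_(j in G) mu (A i j) <= w%:E)%E.
  have <- : mu (\big[setU/set0]_(j in G) A i j) = \sum_(j in G) mu (A i j).
    apply: measure_bigsetU_ord => [j|]; first exact: mA.
    by move=> j j' _ _ [x [[/= Sj _] [/= ]]]; rewrite Sj => -[].
  rewrite -muW; apply: le_measure; rewrite ?inE //.
    by apply: bigsetU_measurable => j _; exact: mA.
  by rewrite -bigcup_pred => x [j _ []].
apply: (le_trans (lee_sum _ (fun i _ => machine i))).
by rewrite sumEFin lee_fin sumr_const card_ord mulr_natl.
Qed.

(** A job without work may have its deadline before its release date, and then its slack is
    negative. *)
Lemma proc_le_window (j : 'I_n) : (0 < proc (J j))%N -> 0 <= slack J j.
Proof.
move=> p0; have : (mu (busy j) <=
    mu `[(release (J j))%:~R, (deadline (J j))%:~R])%E.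
  apply: le_measure; rewrite ?inE //; first exact: measurable_busy.
  exact: busy_window.
rewrite mu_busy lebesgue_measure_itv /= lte_fin ltr_int.
case: ifP => [_|]; last by rewrite lee_fin lern0; lia.
by rewrite -EFinB lee_fin -intrB pmulrn ler_int /slack; lia.
Qed.

(** Work outside [[x, y]] is bounded by the length of the rest of the window; the remaining work
    must fall into [[x, y]]. *)
Lemma busy_itv_ge (j : 'I_n) (x y : R) : x <= y ->
  (release (J j))%:~R <= x -> y <= (deadline (J j))%:~R ->
  ((y - x - (slack J j)%:~R)%:E <= mu (busy j `&` `[x, y]))%E.
Proof.
move=> xy rx yd; set W := `[x, y].
set I := `[(release (J j))%:~R, (deadline (J j))%:~R] : set R.
have mB := measurable_busy j.
have WI : W `<=` I.
  move=> z; rewrite /W /I /= !in_itv /= => /andP[xz zy].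
  by rewrite (le_trans rx xz) (le_trans zy yd).
have muW : mu W = (y - x)%:E.
  rewrite lebesgue_measure_itv /= lte_fin; case: ltgtP xy => // -> _.
  by rewrite subrr.
have muI : mu I = ((deadline (J j))%:~R - (release (J j))%:~R)%:E.
  rewrite lebesgue_measure_itv /= lte_fin.
  case: ltgtP (le_trans rx (le_trans xy yd)) => // -> _.
  by rewrite subrr.
have muIW : (mu (busy j `\` W) <=
    ((deadline (J j))%:~R - (release (J j))%:~R - (y - x))%:E)%E.
  rewrite EFinB -muI -muW -{2}(setIidr WI).
  have <- : mu (I `\` W) = (mu I - mu (I `&` W))%E.
    apply: measureD; [exact: measurable_itv|exact: measurable_itv|].
    have : (((deadline (J j))%:~R - (release (J j))%:~R : R)%:E < +oo)%E.
      exact: ltry.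
    by rewrite -muI.
  apply: le_measure; rewrite ?inE.
  - by apply: measurableD => //; exact: measurable_itv.
  - by apply: measurableD; exact: measurable_itv.
  - by apply: setSD; exact: busy_window.
have pE : (proc (J j))%:R%:E = (mu (busy j `\` W) + mu (busy j `&` W))%E.
  by rewrite -mu_busy; apply: measureDI => //; exact: measurable_itv.
have : ((proc (J j))%:R%:E <=
    ((deadline (J j))%:~R - (release (J j))%:~R - (y - x))%:E +
    mu (busy j `&` W))%E by rewrite pE leeD2r.
rewrite -leeBlDl // -EFinB; apply: le_trans; rewrite lee_fin /slack.
by rewrite !intrB; lra.
Qed.

Lemma crossing_volume (alpha s L : R) (G : {set 'I_n}) : 0 < alpha -> 0 < L ->
  (forall j : 'I_n, j \in G ->
    [/\ (release (J j))%:~R <= s <= (deadline (J j))%:~R,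
        L <= (deadline (J j) - release (J j))%:~R,
        alpha * (deadline (J j) - release (J j))%:~R <= (proc (J j))%:R &
        (slack J j)%:~R <= 2 * L]) ->
  alpha * #|G|%:R <= (4 + 2 * alpha) * m%:R.
Proof.
(* Half of the interval, less an idle time of at most [2 * L], leaves [alpha * L]. *)
move=> a0 L0 hG; pose y := (2 + alpha) * L; have y0 : 0 < y by rewrite /y; nra.
pose W : set R := `[s - y, s + y].
have muW : mu W = (2 * y)%:E.
  rewrite lebesgue_measure_itv /= lte_fin ifT; last lra.
  by rewrite -EFinB; congr _%:E; ring.
have contrib j : j \in G -> ((alpha * L)%:E <= mu (busy j `&` W))%E.
  move=> /hG [/andP[rs sd] Lw tight slk].
  have sub x z : s - y <= x -> z <= s + y ->
      (mu (busy j `&` `[x, z]) <= mu (busy j `&` W))%E.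
    move=> yx zy; have mB := measurable_busy j.
    apply: le_measure; rewrite ?inE.
    - by apply: measurableI => //; exact: measurable_itv.
    - by apply: measurableI => //; exact: measurable_itv.
    apply: setIS => t; rewrite /W /= !in_itv /= => /andP[xt tz].
    by rewrite (le_trans yx xt) (le_trans tz zy).
  have ys : s - y <= s by lra.
  have sy : s <= s + y by lra.
  have yE : y = 2 * L + alpha * L by rewrite /y; ring.
  have [rj|rj] := leP (release (J j))%:~R (s - y).
    apply: (le_trans _ (sub _ _ (lexx _) sy)).
    by apply: (le_trans _ (busy_itv_ge j _ _ ys rj sd)); rewrite lee_fin; lra.
  have [dj|dj] := leP (s + y) (deadline (J j))%:~R.
    apply: (le_trans _ (sub _ _ ys (lexx _))).
    by apply: (le_trans _ (busy_itv_ge j _ _ sy rs dj)); rewrite lee_fin; lra.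
  rewrite setIidl; first by rewrite mu_busy lee_fin; nra.
  move=> x /busy_window; rewrite /W /= !in_itv /= => /andP[rx xd].
  by apply/andP; split; lra.
have := le_trans (lee_sum _ contrib) (sum_busy_le G W _ (measurable_itv _) muW).
rewrite sumEFin lee_fin sumr_const -mulr_natr => vol.
rewrite -(ler_pM2l L0); rewrite /y in vol; nra.
Qed.

End Volume.

(** * From the discrete simulation to a feasible schedule in real time *)

Section Schedule.
Local Open Scope classical_set_scope.

Lemma measurable_floor_preimage {R : realType} (P : set int) :
  measurable [set x : R | P (Num.floor x)].
Proof.
have -> : [set x : R | P (Num.floor x)] =
    \bigcup_(t in P) `[(t%:~R : R), (t + 1)%:~R[.
  apply/seteqP; split=> x /= => [Px|[t Pt]]; last first.
    by rewrite /= in_itv /= => /floor_def ->.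
  by exists (Num.floor x) => //; rewrite /= in_itv /= floor_itv.
rewrite bigcup_mkcond; apply: countable_bigcupT_measurable => // t.
by case: ifP.
Qed.

Context {n : nat} (J : 'I_n -> job) (k : nat).

(** [precedes] is a strict order: whatever precedes [i] precedes [j], and [i] precedes [j] but not
    itself. *)
Lemma llf_rank_lt (rem : 'I_n -> nat) (t : int) (i j : 'I_n) :
  eligible J rem t i -> precedes J rem t i j ->
  (llf_rank J rem t i < llf_rank J rem t j)%N.
Proof.
move=> ei pij; apply/proper_card/properP; split.
  apply/fintype.subsetP => h; rewrite !inE => /andP[-> phi] /=.
  by move: pij phi; rewrite /precedes; lia.
by exists i; rewrite !inE ?ei // /precedes; lia.
Qed.

Lemma llf_rank_inj (rem : 'I_n -> nat) (t : int) (i j : 'I_n) :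
  eligible J rem t i -> eligible J rem t j ->
  llf_rank J rem t i = llf_rank J rem t j -> i = j.
Proof.
move=> ei ej rij; have := llf_rank_lt rem t i j ei.
have := llf_rank_lt rem t j i ej.
rewrite rij ltnn => pji pij; apply/val_inj => /=.
by move: pji pij; rewrite /precedes; lia.
Qed.

Context {R : realType}.
Local Notation rem := (llf_rem J k).
Local Notation chosen t := (llf_choice J k (rem t) t).

Lemma llf_scheduleP (i : 'I_k) (x : R) (j : 'I_n) :
  reflect (llf_schedule J k R i x = Some j)
    (eligible J (rem (Num.floor x)) (Num.floor x) j &&
     (llf_rank J (rem (Num.floor x)) (Num.floor x) j == i :> nat)).
Proof.
rewrite /llf_schedule; apply: (iffP idP) => [/andP[ej /eqP rj]|].
  case: pickP => [h /andP[eh /eqP rh]|/(_ j)]; last by rewrite ej rj eqxx.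
  by congr Some; apply: llf_rank_inj eh ej _; rewrite rh.
by case: pickP => // h hh [<-].
Qed.

Lemma llf_busyE (j : 'I_n) :
  [set x | exists i : 'I_k, llf_schedule J k R i x = Some j] =
  [set x | chosen (Num.floor x) j].
Proof.
apply/seteqP; split=> x /= [].
  move=> i /llf_scheduleP/andP[ej /eqP rj].
  by rewrite /llf_choice ej rj ltn_ord.
move=> /andP[ej rk]; exists (Ordinal rk).
by apply/llf_scheduleP; rewrite ej eqxx.
Qed.

(** By induction on [s]: each step at which [j] is chosen adds a disjoint interval of length one. *)
Lemma mu_llf_busy_before (j : 'I_n) (s : nat) :
  (@lebesgue_measure R [set x : R | (Num.floor x < llf_start J + s%:Z)%R /\
                                chosen (Num.floor x) j] =
   (proc (J j) - rem (llf_start J + s%:Z)%R j)%:R%:E)%E.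
Proof.
elim: s => [|s IH].
  rewrite addr0 llf_rem_before // subnn.
  transitivity (@lebesgue_measure R set0); last by rewrite measure0.
  congr lebesgue_measure; apply/seteqP; split=> x //= [xs].
  by case/chosen_eligible/and3P; have := llf_start_le_release J j; lia.
set t := llf_start J + s%:Z.
have -> : llf_start J + s.+1%:Z = t + 1 by rewrite /t; lia.
(* Needed because the subtraction of naturals is truncated. *)
have remt : (rem t j <= proc (J j))%N.
  rewrite /t; elim: (s) => [|r IHr]; first by rewrite llf_rem_before; lia.
  have -> : llf_start J + r.+1%:Z = llf_start J + r%:Z + 1 by lia.
  by rewrite llf_remS; lia.
rewrite llf_remS; case: (boolP (chosen t j)) => [cj|ncj]; last first.
  rewrite subn0 -IH; congr lebesgue_measure; apply/seteqP.
  split=> x /= [xt cx]; split=> //; last lia.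
  have [xE|] := eqVneq (Num.floor x) t; last lia.
  by move: cx; rewrite xE (negbTE ncj).
have -> : [set x : R | Num.floor x < t + 1 /\ chosen (Num.floor x) j] =
    [set x : R | Num.floor x < t /\ chosen (Num.floor x) j] `|`
    `[t%:~R, (t + 1)%:~R[.
  apply/seteqP; split=> x /=.
    move=> [xt cx]; have [xE|xE] := eqVneq (Num.floor x) t.
      by right; rewrite /= in_itv /= -xE floor_itv.
    by left; split=> //; lia.
  case=> [[xt cx]|]; first by split=> //; lia.
  by rewrite in_itv /= => /floor_def ->; split=> //; lia.
rewrite measureU //; last 2 first.
- exact: (measurable_floor_preimage (fun u : int => u < t /\ chosen u j)).
- apply/seteqP; split=> x //= -[[xt _]]; rewrite in_itv /= => /floor_def xE.
  by move: xt; rewrite xE ltxx.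
have rem0 : (0 < rem t j)%N by case/chosen_eligible/and3P: cj.
transitivity ((proc (J j) - rem t j)%:R%:E + 1%:E : \bar R)%E.
  congr (_ + _)%E; first exact: IH.
  etransitivity; first exact: lebesgue_measure_itv.
  rewrite /= lte_fin ltr_int ifT; last lia.
  by rewrite -EFinB -intrB; have -> : t + 1 - t = 1 by lia.
rewrite -EFinD natr1; congr (_%:R%:E); lia.
Qed.

Lemma llf_feasible :
  (forall (t : int) (j : 'I_n), deadline (J j) <= t -> rem t j = 0%N) ->
  feasible J (llf_schedule J k R).
Proof.
move=> done; split.
- move=> i j; rewrite (_ : mkset _ = [set x | [set t | eligible J (rem t) t j &&
      (llf_rank J (rem t) t j == i :> nat)] (Num.floor x)]).
    exact: measurable_floor_preimage.
  by apply/seteqP; split=> x /llf_scheduleP.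
- move=> i i' x j /llf_scheduleP/andP[_ /eqP ri].
  move=> /llf_scheduleP/andP[_ /eqP ri'].
  by apply/val_inj; rewrite /= -ri -ri'.
- move=> i x j /llf_scheduleP/andP[/and3P[rj rem0 lax0] _].
  have /andP[fx xf] := floor_itv x; apply/andP; split.
    by apply: le_trans fx; rewrite ler_int.
  (* Positive remaining time and non-negative laxity put [t + 1] at or before the deadline, so the
     whole unit interval is in the window. *)
  apply: (le_trans (ltW xf)); rewrite ler_int.
  by move: (Num.floor x) rem0 lax0 => t; rewrite /laxity; lia.
- move=> j; rewrite llf_busyE.
  pose s := `|deadline (J j) - llf_start J|%N.
  have ds : deadline (J j) <= llf_start J + s%:Z by rewrite /s; lia.
  have := mu_llf_busy_before j s; rewrite done // subn0 => <-.
  congr lebesgue_measure; apply/seteqP; split=> x /=; last by case.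
  move=> cx; split=> //; case: ltP => // sx; move: cx.
  by move=> /chosen_eligible/and3P[_]; rewrite done //; lia.
Qed.

End Schedule.

(** * Absence of late delays, and feasibility *)

Lemma tight_no_late_delay {R : realType} (alpha : R) {n : nat}
    (J : 'I_n -> job) (m k : nat) (S : schedule R n m) (t : int) :
  feasible J S -> 0 < alpha -> tight alpha J -> agreeable J ->
  (4 + 2 * alpha) * m%:R < alpha * k.+1%:R ->
  laxity_invariant J k t -> no_late_delay J k t.
Proof.
move=> hS a0 htight hagree hk inv j ej nj.
case: ltP => // late; exfalso.
(* Adding one makes [L] positive and absorbs the [+ 1] of the invariant in the bound [2 * L]. *)
pose lax := laxity J (llf_rem J k t) t; pose L := lax j + 1.
pose P := [set i | eligible J (llf_rem J k t) t i &&
                   precedes J (llf_rem J k t) t i j].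
have kP : (k <= #|P|)%N by move: nj; rewrite /llf_choice ej -leqNgt.
have jP : j \notin P by rewrite inE ej /= /precedes; lia.
have cardG : #|j |: P| = #|P|.+1 by rewrite cardsU1 jP.
have /and3P[rj remj lax0] := ej.
have := @crossing_volume R n m J S hS alpha t%:~R L%:~R (j |: P) a0.
have L0 : (0 : R) < L%:~R by rewrite ltr0z /L /lax; lia.
move=> /(_ L0) vol; move: hk; apply/negP; rewrite -leNgt.
apply: le_trans (vol _); first by rewrite ler_pM2l // ler_nat cardG.
move=> i; rewrite !inE => iG.
have ei : eligible J (llf_rem J k t) t i.
  by case/orP: iG => [/eqP ->|/andP[]].
have laxi : lax i <= lax j.
  case/orP: iG => [/eqP -> //|/andP[_]]; rewrite /precedes /lax; lia.
have /and3P[ri remi laxi0] := ei.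
have [_ _ slki] := inv i ri remi.
have di : t + 1 <= deadline (J i) by move: laxi0; rewrite /laxity; lia.
split.
- by rewrite !ler_int ri; lia.
(* If [i] is released after [j], its window is at least [deadline (J j) - t], which is [lax j] plus
   the positive remaining time of [j]. Otherwise lateness gives [lax j] units before [t], and [di]
   one more after it. *)
- rewrite ler_int; have [rji|rji] := ltP (release (J j)) (release (J i)).
    have := hagree _ _ rji; rewrite /L /lax; move: remj; rewrite /laxity; lia.
  by rewrite /L /lax; lia.
- exact/ltW/htight.
- have -> : 2 * L%:~R = (2 * L)%:~R :> R by rewrite intrM.
  by rewrite ler_int; move: laxi slki; rewrite /L /lax; lia.
Qed.

Theorem theorem3 (R : realType) (alpha : R) (n : nat) (J : 'I_n -> job)
    (m k : nat) (halpha : 0 < alpha < 1) (hm : min_machines R J m)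
    (htight : tight alpha J) (hagree : agreeable J)
    (hk : (4 / alpha + 6) * m%:R <= k%:R) :
  feasible J (llf_schedule J k R).
Proof.
have [[S hS] _] := hm; have /andP[a0 _] := halpha.
have slack0 := proc_le_window hS.
(* Strictness comes from the extra [alpha] contributed by [k.+1], hence also holds for [m = 0]. *)
have km : (4 + 2 * alpha) * m%:R < alpha * k.+1%:R.
  have : alpha * ((4 / alpha + 6) * m%:R) <= alpha * k%:R by rewrite ler_pM2l.
  have -> : alpha * ((4 / alpha + 6) * m%:R) = (4 + 6 * alpha) * m%:R.
    by field; rewrite gt_eqF.
  have : 0 <= alpha * m%:R by rewrite mulr_ge0 // ltW.
  by rewrite -natr1; lra.
have inv := laxity_invariant_llf J k slack0
  (fun t => tight_no_late_delay _ _ _ _ _ t hS a0 htight hagree km).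
apply: llf_feasible => t j dt; apply/eqP; rewrite -leqn0 leqNgt; apply/negP.
(* Work left at or after the deadline would mean negative slack if [j] is not released before [t],
   and negative laxity otherwise. *)
move=> rem0; have [tr|rt] := leP t (release (J j)).
  rewrite llf_rem_release // in rem0; have := slack0 j rem0.
  by rewrite /slack; lia.
by have [] := inv t j (ltW rt) rem0; rewrite /laxity; lia.
Qed.
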